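(* (1) $\mathbf{K_N^{Horn,\Diamond}}\prec\mathbf{K_N^{Horn}}$; (2) $\mathbf{K_N^{core,\Diamond}}\prec\mathbf{K_N^{core}}$.
   Context: Fix a finite set $\tau$ of modality labels and a countable set $\mathcal P$ of propositional letters. Formulas of $\mathbf{K_N}$ are generated by $\varphi ::= \top \mid p \mid \neg\varphi \mid \varphi\vee\varphi \mid \Diamond_\alpha\varphi \mid \Box_\alpha\varphi$; $\wedge,\rightarrow$ are abbreviations, $\bot=\neg\top$. Models $M=(\mathcal F,V)$ with frame $\mathcal F=(W,\{R_\alpha\}_{\alpha\in\tau})$, $W\neq\emptyset$, $R_\alpha\subseteq W\times W$, $V:W\to2^{\mathcal P}$, standard Kripke semantics. Positive literals: $\lambda ::= \top \mid p \mid \Diamond_\alpha\lambda \mid \Box_\alpha\lambda$. Clausal form: $\varphi ::= \lambda \mid \neg\lambda \mid \nabla(\neg\lambda_1\vee\dots\vee\neg\lambda_n\vee\lambda_{n+1}\vee\dots\vee\lambda_{n+m}) \mid \varphi\wedge\varphi$, with positive literals $\lambda,\lambda_i$ and $\nabla$ a finite (possibly empty) sequence of boxes. $\mathbf{K_N^{Horn}}$: every clause has $m\le1$; $\mathbf{K_N^{Krom}}$: $n+m\le2$; $\mathbf{K_N^{core}}$: both. For $X\in\{\mathrm{Horn},\mathrm{core}\}$, $\mathbf{K_N^{X,\Diamond}}$ is the subfragment of $\mathbf{K_N^{X}}$ in which positive literals contain no boxes ($\lambda::=\top\mid p\mid\Diamond_\alpha\lambda$; prefixes $\nabla$ unchanged).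 Strong expressivity (over all Kripke frames): for a model $M=(\mathcal F,V)$ over $\mathcal P$ and $\mathcal P'\supseteq\mathcal P$, an extension of $M$ is a model $(\mathcal F,V')$ over $\mathcal P'$ with $V'$ agreeing with $V$ on $\mathcal P$. $\mathbf L\preceq\mathbf L'$ if there is an effective translation taking each $\mathbf L$-formula $\varphi$ over $\mathcal P$ to an $\mathbf L'$-formula $\varphi'$ over some alphabet $\mathcal P'\supseteq\mathcal P$ (adding finitely many new letters) such that for every model $M$ over $\mathcal P$ and world $w$: $M,w\Vdash\varphi$ iff some extension $M'$ of $M$ to $\mathcal P'$ satisfies $M',w\Vdash\varphi'$. $\mathbf L\equiv\mathbf L'$ means both directions of $\preceq$; $\mathbf L\prec\mathbf L'$ means $\mathbf L\preceq\mathbf L'$ and not $\mathbf L\equiv\mathbf L'$. *)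

(* Defs.v *)
From HB Require Import structures.
From mathcomp Require Import all_boot.

Set Implicit Arguments.
Unset Strict Implicit.
Unset Printing Implicit Defensive.

Inductive form (tau : finType) (Q : Type) : Type :=
  | Top
  | Var of Q
  | Neg of form tau Q
  | Or of form tau Q & form tau Q
  | Dia of tau & form tau Q
  | Box of tau & form tau Q.

Arguments Top {tau Q}.
Arguments Var {tau Q}.

Definition Bot {tau : finType} {Q : Type} : form tau Q := Neg Top.

Definition And {tau : finType} {Q : Type} (f g : form tau Q) : form tau Q :=
  Neg (Or (Neg f) (Neg g)).

Record frame (tau : finType) := Frame {
  world : Type;
  world_inhabited : inhabited world;
  acc : tau -> world -> world -> Prop
}.

Definition valuation (tau : finType) (F : frame tau) (Q : Type) :=
  world F -> Q -> Prop.

Fixpoint sat (tau : finType) (Q : Type) (F : frame tau) (V : valuation F Q)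
    (w : world F) (f : form tau Q) : Prop :=
  match f with
  | Top => True
  | Var p => V w p
  | Neg g => ~ sat V w g
  | Or g h => sat V w g \/ sat V w h
  | Dia a g => exists2 v, acc a w v & sat V v g
  | Box a g => forall v, acc a w v -> sat V v g
  end.

Fixpoint poslit (tau : finType) (Q : Type) (f : form tau Q) : bool :=
  match f with
  | Top | Var _ => true
  | Dia _ g | Box _ g => poslit g
  | Neg _ | Or _ _ => false
  end.

Fixpoint poslit_dia (tau : finType) (Q : Type) (f : form tau Q) : bool :=
  match f with
  | Top | Var _ => true
  | Dia _ g => poslit_dia g
  | Neg _ | Or _ _ | Box _ _ => false
  end.

(* The empty disjunction is Bot = Neg Top, which is also the one-literal       *)
(* clause n = 1, m = 0 with literal Top: whether n + m = 0 is allowed in the   *)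
(* fragments below therefore does not change them.                             *)
Fixpoint disj (tau : finType) (Q : Type) (s : seq (form tau Q)) : form tau Q :=
  match s with
  | [::] => Bot
  | [:: f] => f
  | f :: s' => Or f (disj s')
  end.

Definition boxes (tau : finType) (Q : Type) (nabla : seq tau)
    (f : form tau Q) : form tau Q :=
  foldr (fun a g => Box a g) f nabla.

(* lit is the class of positive literals, and ok n m the restriction on the    *)
(* numbers n of negative and m of positive literals of each clause.            *)
Inductive clausal (tau : finType) (Q : Type) (lit : form tau Q -> bool)
    (ok : nat -> nat -> bool) : form tau Q -> Prop :=
  | clausal_pos f : lit f -> clausal lit ok f
  | clausal_neg f : lit f -> clausal lit ok (Neg f)
  | clausal_clause (nabla : seq tau) (negs poss : seq (form tau Q)) :
      all lit negs -> all lit poss -> ok (size negs) (size poss) ->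
      clausal lit ok
        (boxes nabla (disj (map (fun l => Neg l) negs ++ poss)))
  | clausal_and f g :
      clausal lit ok f -> clausal lit ok g -> clausal lit ok (And f g).

Definition horn_size (n m : nat) : bool := m <= 1.
Definition core_size (n m : nat) : bool := (m <= 1) && (n + m <= 2).

(* A fragment selects formulas uniformly in the alphabet. *)
Definition fragment (tau : finType) := forall Q : Type, form tau Q -> Prop.

Definition K_horn (tau : finType) : fragment tau :=
  fun Q => clausal (@poslit tau Q) horn_size.
Definition K_core (tau : finType) : fragment tau :=
  fun Q => clausal (@poslit tau Q) core_size.
Definition K_horn_dia (tau : finType) : fragment tau :=
  fun Q => clausal (@poslit_dia tau Q) horn_size.
Definition K_core_dia (tau : finType) : fragment tau :=
  fun Q => clausal (@poslit_dia tau Q) core_size.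

Arguments K_horn : clear implicits.
Arguments K_core : clear implicits.
Arguments K_horn_dia : clear implicits.
Arguments K_core_dia : clear implicits.

(* Kleene's partial recursive functions; reval e v y says that e is defined on *)
(* v with value y.                                                             *)
Inductive recfun : nat -> Type :=
  | RZero n : recfun n
  | RSucc : recfun 1
  | RProj n : 'I_n -> recfun n
  | RComp m n : recfun m -> ('I_m -> recfun n) -> recfun n
  | RPrec n : recfun n -> recfun n.+2 -> recfun n.+1
  | RMu n : recfun n.+1 -> recfun n.

Inductive reval : forall n, recfun n -> n.-tuple nat -> nat -> Prop :=
  | reval_zero n (v : n.-tuple nat) : reval (RZero n) v 0
  | reval_succ x : reval RSucc [tuple x] x.+1
  | reval_proj n (i : 'I_n) (v : n.-tuple nat) : reval (RProj i) v (tnth v i)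
  | reval_comp m n (e : recfun m) (es : 'I_m -> recfun n) (v : n.-tuple nat)
      (u : m.-tuple nat) y :
      (forall i, reval (es i) v (tnth u i)) -> reval e u y ->
      reval (RComp e es) v y
  | reval_prec0 n (e : recfun n) (h : recfun n.+2) (v : n.-tuple nat) y :
      reval e v y -> reval (RPrec e h) [tuple of 0 :: v] y
  | reval_precS n (e : recfun n) (h : recfun n.+2) (v : n.-tuple nat) k z y :
      reval (RPrec e h) [tuple of k :: v] z ->
      reval h [tuple of k :: z :: v] y ->
      reval (RPrec e h) [tuple of k.+1 :: v] y
  | reval_mu n (e : recfun n.+1) (v : n.-tuple nat) k (z : nat -> nat) :
      (forall j, j < k -> reval e [tuple of j :: v] (z j).+1) ->
      reval e [tuple of k :: v] 0 ->
      reval (RMu e) v k.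

(* Goedel number of a formula, relative to a numbering c of its letters;       *)
(* CodeSeq.code is a bijection from seq nat to nat.                            *)
Fixpoint godel (tau : finType) (Q : Type) (c : Q -> nat) (f : form tau Q)
    : nat :=
  match f with
  | Top => CodeSeq.code [:: 0]
  | Var p => CodeSeq.code [:: 1; c p]
  | Neg g => CodeSeq.code [:: 2; godel c g]
  | Or g h => CodeSeq.code [:: 3; godel c g; godel c h]
  | Dia a g => CodeSeq.code [:: 4; nat_of_ord (enum_rank a); godel c g]
  | Box a g => CodeSeq.code [:: 5; nat_of_ord (enum_rank a); godel c g]
  end.

(* Letters of P are numbered by even numbers, new letters by odd ones, so that *)
(* a letter of P has the same number in P and in each P + 'I_k.                *)
Definition letter_num (P : countType) (p : P) : nat := (pickle p).*2.

Definition ext_letter_num (P : countType) (k : nat) (x : P + 'I_k) : nat :=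
  match x with
  | inl p => letter_num p
  | inr i => (nat_of_ord i).*2.+1
  end.

(* A translation maps a formula over P to a number k of new letters together   *)
(* with a formula over P + 'I_k.                                               *)
Definition translation (tau : finType) (P : countType) :=
  form tau P -> {k : nat & form tau (P + 'I_k)%type}.

Definition effective_on (tau : finType) (P : countType)
    (D : form tau P -> Prop) (t : translation tau P) : Prop :=
  exists ek ef : recfun 1, forall f : form tau P, D f ->
    reval ek [tuple godel (@letter_num P) f] (projT1 (t f)) /\
    reval ef [tuple godel (@letter_num P) f]
      (godel (@ext_letter_num P (projT1 (t f))) (projT2 (t f))).

Definition extends (tau : finType) (F : frame tau) (P : Type) (k : nat)
    (V : valuation F P) (V' : valuation F (P + 'I_k)%type) : Prop :=
  forall w p, V' w (inl p) <-> V w p.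

Definition expr_le (tau : finType) (P : countType) (L L' : fragment tau)
    : Prop :=
  exists t : translation tau P,
    effective_on (L P) t /\
    forall f : form tau P, L P f ->
      L' (P + 'I_(projT1 (t f)))%type (projT2 (t f)) /\
      forall (F : frame tau) (V : valuation F P) (w : world F),
        sat V w f <->
        exists V' : valuation F (P + 'I_(projT1 (t f)))%type,
          extends V V' /\ sat V' w (projT2 (t f)).

Definition expr_equiv (tau : finType) (P : countType) (L L' : fragment tau)
    : Prop :=
  expr_le P L L' /\ expr_le P L' L.

Definition expr_lt (tau : finType) (P : countType) (L L' : fragment tau)
    : Prop :=
  expr_le P L L' /\ ~ expr_equiv P L L'.

(* Main.v *)
Require Import Defs.
From HB Require Import structures.
From mathcomp Require Import all_boot.

(** Positive literals without boxes hold at a point of a direct product of two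
    models iff they hold at both coordinates, so Horn formulas over such
    literals are preserved by direct products, also after existentially
    quantifying the new letters. The core formula
    [~ <a>[a]<a>T \/ <a><a><a>T] is not preserved: it holds at the root of the
    chain 0 -> 1 -> 2 and at the root of the tree 0 -> 1 -> 2 -> 3, 0 -> 4, but
    in the product the pair (1, 4) is a dead end, which makes [<a>[a]<a>T] true,
    while no path has length 3. No letter occurs in it, so the alphabet may even
    be empty. *)

Set Implicit Arguments.
Unset Strict Implicit.
Unset Printing Implicit Defensive.

Section Renaming.
Variable tau : finType.

Fixpoint map_form (Q Q' : Type) (g : Q -> Q') (f : form tau Q) : form tau Q' :=
  match f with
  | Top => Top
  | Var p => Var (g p)
  | Neg f1 => Neg (map_form g f1)
  | Or f1 f2 => Or (map_form g f1) (map_form g f2)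
  | Dia a f1 => Dia a (map_form g f1)
  | Box a f1 => Box a (map_form g f1)
  end.

Lemma godel_map_form (Q Q' : Type) (g : Q -> Q') (c : Q -> nat)
    (c' : Q' -> nat) (f : form tau Q) :
  (forall p, c' (g p) = c p) -> godel c' (map_form g f) = godel c f.
Proof.
by move=> cg; elim: f => //= [p|f ->|f -> h ->|a f ->|a f ->] //; rewrite cg.
Qed.

Lemma sat_map_form (Q Q' : Type) (g : Q -> Q') (F : frame tau)
    (V : valuation F Q) (V' : valuation F Q') (f : form tau Q) :
  (forall w p, V' w (g p) <-> V w p) ->
  forall w, sat V' w (map_form g f) <-> sat V w f.
Proof.
move=> gV; elim: f => //= [f IHf|f IHf h IHh|a f IHf|a f IHf] w.
- by have := IHf w; tauto.
- by have := IHf w; have := IHh w; tauto.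
- by split=> -[v wv /IHf]; exists v.
- by split=> H v /H /IHf.
Qed.

Lemma map_form_disj (Q Q' : Type) (g : Q -> Q') (s : seq (form tau Q)) :
  map_form g (disj s) = disj (map (map_form g) s).
Proof. by elim: s => [|f [|h s] IH] //=; rewrite IH. Qed.

Lemma map_form_boxes (Q Q' : Type) (g : Q -> Q') (nabla : seq tau)
    (f : form tau Q) :
  map_form g (boxes nabla f) = boxes nabla (map_form g f).
Proof. by elim: nabla => //= a s ->. Qed.

Lemma clausal_map_form (Q Q' : Type) (g : Q -> Q') (lit : form tau Q -> bool)
    (lit' : form tau Q' -> bool) (ok : nat -> nat -> bool) (f : form tau Q) :
  (forall l, lit l -> lit' (map_form g l)) ->
  clausal lit ok f -> clausal lit' ok (map_form g f).
Proof.
move=> glit; have gall s : all lit s -> all lit' (map (map_form g) s).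
  by rewrite all_map; apply: sub_all.
elim=> {f} [f litf|f litf|nabla negs poss litn litp szok|f h _ IHf _ IHh] /=.
- exact/clausal_pos/glit.
- exact/clausal_neg/glit.
- rewrite map_form_boxes map_form_disj map_cat -map_comp.
  rewrite (@eq_map _ _ _ (Neg (Q:=Q') \o map_form g)) // map_comp.
  by apply: clausal_clause; rewrite ?gall ?size_map.
- exact: clausal_and.
Qed.

Lemma poslit_dia_poslit_map (Q Q' : Type) (g : Q -> Q') (f : form tau Q) :
  poslit_dia f -> poslit (map_form g f).
Proof. by elim: f. Qed.

End Renaming.

(** Reading [f] in the alphabet extended by zero letters is a translation. It is effective because
    letters of [P] keep their numbers, so Gödel numbers do not change and the identity projection
    computes it. *)
Lemma expr_le_of_map_inl (tau : finType) (P : countType) (L L' : fragment tau) :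
  (forall f : form tau P, L P f ->
     L' (P + 'I_0)%type (map_form (fun p => inl p) f)) ->
  expr_le P L L'.
Proof.
move=> LL'.
exists (fun f => existT (fun k => form tau (P + 'I_k)%type) 0
                   (map_form (fun p => inl p) f)).
split=> [|f Lf].
  exists (RZero 1), (RProj ord0) => f _ /=; split; first exact: reval_zero.
  rewrite (@godel_map_form _ _ _ _ (@letter_num P)) //.
  exact: (reval_proj ord0 [tuple godel (@letter_num P) f]).
split=> [|F V w /=]; first exact: LL'.
split=> [wf|[V' [VV']]]; last by move/(sat_map_form f VV').
(* The [False] branch is never taken, as ['I_0] is empty. *)
exists (fun w x => if x is inl p then V w p else False).
by split=> //; apply/(@sat_map_form _ _ _ _ _ V).
Qed.

Section Product.
Variables (tau : finType) (Q : Type).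

Definition frame_prod (F1 F2 : frame tau) : frame tau :=
  @Frame tau (world F1 * world F2)
    (let: inhabits w1 := world_inhabited F1 in
     let: inhabits w2 := world_inhabited F2 in inhabits (w1, w2))
    (fun a u v => acc a u.1 v.1 /\ acc a u.2 v.2).

Definition val_prod (R : Type) (F1 F2 : frame tau) (V1 : valuation F1 R)
    (V2 : valuation F2 R) : valuation (frame_prod F1 F2) R :=
  fun u p => V1 u.1 p /\ V2 u.2 p.

Variables (F1 F2 : frame tau) (V1 : valuation F1 Q) (V2 : valuation F2 Q).

(** Witnesses of a diamond in the two factors pair up to a witness in the product. A box has no such
    property: a dead end in one coordinate makes it true at the pair. *)
Lemma sat_prod_poslit_dia (l : form tau Q) :
  poslit_dia l -> forall u,
  sat (val_prod V1 V2) u l <-> sat V1 u.1 l /\ sat V2 u.2 l.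
Proof.
elim: l => //= a l IHl litl u.
split=> [[v [uv1 uv2] /(IHl litl)[lv1 lv2]]|[[v1 uv1 lv1] [v2 uv2 lv2]]].
  by split; [exists v.1|exists v.2].
by exists (v1, v2) => //; apply/IHl.
Qed.

Lemma sat_disj_cons (F : frame tau) (V : valuation F Q) (w : world F)
    (f : form tau Q) (s : seq (form tau Q)) :
  sat V w (disj (f :: s)) <-> sat V w f \/ sat V w (disj s).
Proof. by case: s => //=; split=> [|[]] //; left. Qed.

(** A negated literal true in either factor stays true in the product. Otherwise both factors
    satisfy the same positive literal, since there is at most one. *)
Lemma sat_prod_clause (negs poss : seq (form tau Q)) u :
  all (@poslit_dia tau Q) negs -> all (@poslit_dia tau Q) poss ->
  size poss <= 1 ->
  let C := disj (map (fun l => Neg l) negs ++ poss) in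
  sat V1 u.1 C -> sat V2 u.2 C -> sat (val_prod V1 V2) u C.
Proof.
move=> + litp szp /=; elim: negs => [_|l negs IH /andP[litl litn]].
  case: poss litp szp => [_ _ /= f1 _|l [] // /andP[litl _] _ /= l1 l2].
    by case: f1.
  exact/sat_prod_poslit_dia.
move=> /sat_disj_cons[nl1|C1] /sat_disj_cons[nl2|C2]; apply/sat_disj_cons.
- by left=> /(sat_prod_poslit_dia litl)[].
- by left=> /(sat_prod_poslit_dia litl)[].
- by left=> /(sat_prod_poslit_dia litl)[].
- by right; apply: IH.
Qed.

Lemma sat_prod_horn_dia (f : form tau Q) u :
  K_horn_dia tau Q f ->
  sat V1 u.1 f -> sat V2 u.2 f -> sat (val_prod V1 V2) u f.
Proof.
move=> Kf; elim: Kf u => {f} [f litf|f litf|nabla negs poss litn litp szok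
  |f g _ IHf _ IHg] u.
- by move=> f1 f2; apply/sat_prod_poslit_dia.
- by move=> /= nf1 _ /(sat_prod_poslit_dia litf)[].
- elim: nabla u => [|a nabla IH] u; first exact: sat_prod_clause.
  move=> /= H1 H2 v [uv1 uv2].
  by apply: IH; [apply: H1|apply: H2].
(* [And] is a negated disjunction of negations, so the conjuncts are extracted constructively, under
   the goal [False]. *)
- move=> /= H1 H2 [nf|ng]; apply: H1.
    by left=> f1; apply: H2; left=> f2; apply/nf/IHf.
  by right=> g1; apply: H2; right=> g2; apply/ng/IHg.
Qed.

End Product.

Section Separation.
Variables (tau : finType) (P : countType) (a : tau).

Definition sep_form : form tau P :=
  disj (map (fun l => Neg l) [:: Dia a (Box a (Dia a Top))]
        ++ [:: Dia a (Dia a (Dia a Top))]).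

Definition nat_frame (R : nat -> nat -> Prop) : frame tau :=
  @Frame tau nat (inhabits 0) (fun _ => R).

Definition nat_val (R : nat -> nat -> Prop) : valuation (nat_frame R) P :=
  fun _ _ => False.
Arguments nat_val : clear implicits.

Definition chain_rel (i j : nat) : Prop := (i, j) \in [:: (0, 1); (1, 2)].
Definition tree_rel (i j : nat) : Prop :=
  (i, j) \in [:: (0, 1); (1, 2); (2, 3); (0, 4)].

Lemma sep_form_chain : sat (nat_val chain_rel) 0 sep_form.
Proof.
(* The only successor of 0 is 1, and its successor 2 is a dead end. *)
left=> -[[|[|v]] //= _ /(_ 2 isT)[w]].
by rewrite /chain_rel !inE.
Qed.

Lemma sep_form_tree : sat (nat_val tree_rel) 0 sep_form.
Proof. by right; exists 1 => //; exists 2 => //; exists 3. Qed.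

Lemma sep_form_prod :
  ~ sat (val_prod (nat_val chain_rel) (nat_val tree_rel)) (0, 0) sep_form.
Proof.
case=> /=; first apply.
  by exists (1, 4) => // -[v1 v2] [_]; rewrite /tree_rel /= !inE !xpair_eqE.
(* A path of length 3 would project to one in the chain. *)
case=> -[v1 v2] [/= + _] [[w1 w2]] [/= + _] [[x1 x2]] [/= + _] _.
by rewrite /chain_rel !inE !xpair_eqE; case: v1 w1 => [|[|[|?]]] [|[|[|?]]].
Qed.

Lemma sep_form_core : K_core tau P sep_form.
Proof.
exact: (@clausal_clause _ _ _ _ [::] [:: Dia a (Box a (Dia a Top))]
          [:: Dia a (Dia a (Dia a Top))]).
Qed.

(** Stated for arbitrary [L] and [L'] so that one formula settles both the Horn and the core
    case. *)
Lemma not_expr_le_horn_dia (L L' : fragment tau) :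
  L P sep_form -> (forall Q f, L' Q f -> K_horn_dia tau Q f) ->
  ~ expr_le P L L'.
Proof.
move=> Lsep L'horn [t [_ /(_ _ Lsep) [/L'horn]]].
move: (projT1 _) (projT2 _) => k f horn_f sepE.
have /sepE[V1 [ext1 f1]] := sep_form_chain.
have /sepE[V2 [ext2 f2]] := sep_form_tree.
(* Products are taken letter by letter, so the product of the two extensions extends the product of
   the original valuations. *)
apply/sep_form_prod/sepE; exists (val_prod V1 V2); split.
  move=> u p; rewrite /val_prod.
  by have := ext1 u.1 p; have := ext2 u.2 p; tauto.
exact: sat_prod_horn_dia.
Qed.

End Separation.

Lemma clausal_sub_size (tau : finType) (Q : Type) (lit : form tau Q -> bool)
    (ok ok' : nat -> nat -> bool) (f : form tau Q) :
  (forall n m, ok n m -> ok' n m) -> clausal lit ok f -> clausal lit ok' f.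
Proof.
move=> okok'; elim=> {f} [f litf|f litf|nabla negs poss litn litp /okok'|f g _ ? _ ?].
- exact: clausal_pos.
- exact: clausal_neg.
- exact: clausal_clause.
- exact: clausal_and.
Qed.

Lemma core_size_horn n m : core_size n m -> horn_size n m.
Proof. by case/andP. Qed.

Theorem theorem4 (tau : finType) (P : countType) (tau_nonempty : 0 < #|tau|) :
  expr_lt P (K_horn_dia tau) (K_horn tau) /\
  expr_lt P (K_core_dia tau) (K_core tau).
Proof.
have /card_gt0P[a _] := tau_nonempty.
have core_sep := @sep_form_core tau P a.
split; split.
- apply: expr_le_of_map_inl => f.
  exact/clausal_map_form/poslit_dia_poslit_map.
- case=> _; apply: (@not_expr_le_horn_dia _ _ a) => //.
  exact: clausal_sub_size core_size_horn core_sep.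
- apply: expr_le_of_map_inl => f.
  exact/clausal_map_form/poslit_dia_poslit_map.
- case=> _; apply: (@not_expr_le_horn_dia _ _ a) => // Q f.
  exact/clausal_sub_size/core_size_horn.
Qed.
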